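(* Let $n\geq 8$ be an integer with $n\not\equiv 1\pmod 3$. Let $\widetilde{L}$ be the $n\times n$ matrix $$\widetilde{L}=\frac{n-1}{3}I_n-\frac13\begin{bmatrix}0&\mathbf{e}'\\ \mathbf{e}&\mathbf{0}\end{bmatrix}+\begin{bmatrix}0&\mathbf{0}'\\ \mathbf{0}&M\end{bmatrix},$$ where $M=\frac13\operatorname{Circ}(\bar{\mathbf{x}}')$ if $n\equiv 2\pmod 3$ and $M=\frac13\operatorname{Circ}(\bar{\mathbf{y}}')$ if $n\equiv 0\pmod 3$, with $\bar{\mathbf{x}},\bar{\mathbf{y}}\in\mathbb{R}^{n-1}$ given by $$\bar{\mathbf{x}}=(2-n,\underbrace{1,-2,1},\dots,\underbrace{1,-2,1})',\qquad \bar{\mathbf{y}}=(-n,\underbrace{2,-1,-1},\dots,\underbrace{2,-1,-1},2)'.$$ Then the rank of $\widetilde{L}$ is $n-1$.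
   Context: The prime denotes transpose, $I_n$ is the identity matrix, and $\mathbf{e}$ denotes the all-ones column vector (here in $\mathbb{R}^{n-1}$). In the block matrices the blocks have sizes $1$ and $n-1$. For a vector $\mathbf{c}=(c_1,\dots,c_m)'$, $\operatorname{Circ}(\mathbf{c}')$ is the $m\times m$ circulant matrix with first row $(c_1,\dots,c_m)$ and each subsequent row the cyclic right shift by one of the previous row. *)

(* Defs.v *)
From mathcomp Require Import all_boot all_order all_algebra.

Set Implicit Arguments.
Unset Strict Implicit.
Unset Printing Implicit Defensive.

Import GRing.Theory.
Local Open Scope ring_scope.

(* [ord_pred m j] is j - 1 modulo m, so the entry (i, j) is c_(j - i mod m):
   row i is c shifted i times cyclically to the right. *)
Definition circ (R : Type) (m : nat) (c : 'rV[R]_m) : 'M[R]_m :=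
  \matrix_(i < m, j < m) c 0 (iter i (@ord_pred m) j).

(* For n = 2 mod 3 and n >= 2 (resp. n = 0 mod 3 and n >= 3), the list below
   has exactly n - 1 entries. *)
Definition xbar (R : fieldType) (n : nat) : 'cV[R]_n.-1 :=
  \col_(j < n.-1)
    ((2 - n%:R) :: flatten (nseq ((n - 2) %/ 3) [:: 1; -2; 1]))`_j.

Definition ybar (R : fieldType) (n : nat) : 'cV[R]_n.-1 :=
  \col_(j < n.-1)
    ((- n%:R) :: rcons (flatten (nseq ((n - 3) %/ 3) [:: 2; -1; -1])) 2)`_j.

(* Only meaningful for n <> 1 mod 3. *)
Definition Mblock (R : fieldType) (n : nat) : 'M[R]_n.-1 :=
  3^-1 *: circ (if n == 2 %[mod 3] then (xbar R n)^T else (ybar R n)^T).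

(* The size n is written 1 + n.-1 to carry the block decomposition. *)
Definition Ltilde (R : fieldType) (n : nat) : 'M[R]_(1 + n.-1) :=
  let e : 'cV[R]_n.-1 := const_mx 1 in
  ((n%:R - 1) / 3)%:M - 3^-1 *: block_mx 0 e^T e 0
    + block_mx 0 0 0 (Mblock R n).

(* Main.v *)
Require Import Defs.
From mathcomp Require Import all_boot all_order all_algebra.
From mathcomp Require Import zify ring.

(* Let [m = n - 1].  The lower right block of [3 Ltilde] is the circulant whose
   first row [b] is the 3-periodic word 1 1 -2 1 1 -2 ... 1 (when m = 1 mod 3)
   or -1 2 -1 -1 2 -1 ... -1 2 (when m = 2 mod 3).  In both cases the sum of
   three cyclically consecutive entries of [b] vanishes, except for the sum
   centred at index 0, which is 3.  Hence this block times I + P + P^-1, with P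
   the cyclic shift, is 3 I: the block is invertible and the rank of [Ltilde]
   is at least m.  Since I + P + P^-1 has row sums 3, the block has row sums 1,
   so the all-ones vector lies in the kernel of [Ltilde]. *)

Set Implicit Arguments.
Unset Strict Implicit.
Unset Printing Implicit Defensive.

Import GRing.Theory.
Local Open Scope ring_scope.

Lemma iter_ordS0 (m i : nat) : (i < m.+1)%N ->
  iter i (@ordS m.+1) ord0 = i :> nat.
Proof.
elim: i => //= i IHi lt_im; rewrite IHi ?(ltnW lt_im) //.
by rewrite modn_small.
Qed.

Lemma iter_ord_pred_eq0 (m : nat) (i j : 'I_m.+1) :
  (iter i (@ord_pred m.+1) j == ord0) = (i == j).
Proof.
have defi : iter i (@ordS m.+1) ord0 = i by apply/val_inj/iter_ordS0.
apply/eqP/eqP=> [j0|<-].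
  rewrite -[LHS]defi -j0; move: (nat_of_ord i) => k.
  by elim: k j {j0} => //= k IHk j; rewrite -iterS iterSr ord_predK IHk.
rewrite -[X in iter _ _ X]defi; move: (nat_of_ord i) => k.
by elim: k => //= k IHk; rewrite -iterS iterSr ordSK IHk.
Qed.

Lemma circD (R : nmodType) (m : nat) (c d : 'rV[R]_m) :
  circ (c + d) = circ c + circ d.
Proof. by apply/matrixP=> i j; rewrite !mxE. Qed.

(** Lets the scalar part of the lower right block be absorbed into the first row of a circulant. *)
Lemma circ_delta0 (R : pzRingType) (m : nat) (a : R) :
  circ (a *: delta_mx 0 0 : 'rV[R]_m.+1) = a%:M.
Proof.
by apply/matrixP=> i j; rewrite !mxE eqxx iter_ord_pred_eq0 mulr_natr.
Qed.

(* I + P + P^-1 *)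
Definition window_mx (R : pzSemiRingType) (m : nat) : 'M[R]_m :=
  \matrix_(i, j)
    ((i == ord_pred j)%:R + (i == j)%:R + (i == ordS j)%:R).

(** Each of the three summands is a permutation matrix, hence has row sums 1. *)
Lemma window_mx_ones (R : pzSemiRingType) (m : nat) :
  window_mx R m *m const_mx 1 = 3 *: const_mx 1 :> 'cV_m.
Proof.
apply/matrixP=> i j; rewrite !mxE mulr1.
under eq_bigr => k _ do rewrite !mxE mulr1.
have sum1 (f g : 'I_m -> 'I_m) : cancel f g -> cancel g f ->
    \sum_k (i == f k)%:R = 1 :> R.
  move=> fK gK; rewrite (bigD1 (g i)) //= gK eqxx big1 ?addr0 // => k.
  by case: (i =P f k) => [->|//]; rewrite fK eqxx.
rewrite !big_split /= (sum1 _ _ (@ord_predK m) (@ordSK m)).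
by rewrite (sum1 id id) // (sum1 _ _ (@ordSK m) (@ord_predK m)) -addrA.
Qed.

(** Circulants commute with the cyclic shift, so windowing the columns amounts to windowing the
    first row. *)
Lemma circ_mul_window (R : pzSemiRingType) (m : nat) (c : 'rV[R]_m) :
  circ c *m window_mx R m =
  circ (\row_k (c 0 (ord_pred k) + c 0 k + c 0 (ordS k))).
Proof.
apply/matrixP=> i j; rewrite !mxE.
under eq_bigr => k _ do rewrite !mxE !mulrDr.
have sum1 (l : 'I_m) (F : 'I_m -> R) : \sum_k F k * (k == l)%:R = F l.
  rewrite (bigD1 l) //= eqxx mulr1 big1 ?addr0 // => k /negPf->.
  by rewrite mulr0.
rewrite !big_split /= !sum1 -iterSr iterS; congr (_ + c 0 _).
(* It remains to move [ordS] out of the iterated [ord_pred]; for a positive exponent both sides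
   cancel to [iter k ord_pred j]. *)
case: (nat_of_ord i) => [|k] //=.
rewrite -iterS iterSr ordSK.
by rewrite -iterS iterSr -iterSr iterS ord_predK.
Qed.

Lemma nth_flatten_nseq3 (T : Type) (x a b c : T) (k j : nat) : (j < 3 * k)%N ->
  nth x (flatten (nseq k [:: a; b; c])) j = nth x [:: a; b; c] (j %% 3).
Proof.
elim: k j => [|k IHk] [|[|[|j]]] //= ltj.
by rewrite IHk -?[j.+3]addn3 ?modnDr //; lia.
Qed.

(** Here [s] gives one period of [b]. A window that does not wrap around meets each residue mod 3
    once, so it sums to zero. The last two hypotheses handle the wrapping windows, centred at 0 and
    at [m - 1]. *)
Lemma three_window (R : comNzRingType) (m : nat) (s b : nat -> R) :
    (2 < m)%N ->
    (forall j, (j < m)%N -> b j = s (j %% 3)%N) ->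
    s 0%N + s 1%N + s 2%N = 0 ->
    s (m.-1 %% 3)%N + s 0%N + s 1%N = 3 ->
    s ((m - 2) %% 3)%N + s (m.-1 %% 3)%N + s 0%N = 0 ->
  forall k : 'I_m, b (ord_pred k) + b k + b (ordS k) = 3 * (k == 0 :> nat)%:R.
Proof.
move=> m2 bE s012 s0 sl [k ltkm] /=.
have [->|k0] := eqVneq k 0%N.
  rewrite add0n !modn_small ?prednK; try lia.
  by rewrite !bE ?mulr1 -?s0; try lia.
rewrite mulr0; have -> : ((k + m).-1 %% m = k.-1)%N.
  by rewrite -subn1 -addnBAC ?subn1 ?modnDr ?modn_small; lia.
have [km|km] := eqVneq k.+1 m.
  rewrite km modnn !bE; try lia.
  by rewrite -sl -km; congr (s (_ %% _)%N + _ + _); lia.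
rewrite modn_small; last by lia.
rewrite !bE; try lia; rewrite -s012.
have [[-> -> ->]|[[-> -> ->]|[-> -> ->]]] :
    [/\ (k.-1 %% 3 = 0)%N, (k %% 3 = 1)%N & (k.+1 %% 3 = 2)%N] \/
    ([/\ (k.-1 %% 3 = 1)%N, (k %% 3 = 2)%N & (k.+1 %% 3 = 0)%N] \/
    [/\ (k.-1 %% 3 = 2)%N, (k %% 3 = 0)%N & (k.+1 %% 3 = 1)%N]).
- have : (k %% 3 < 3)%N by rewrite ltn_mod.
  case E: (k %% 3)%N => [|[|[|r]]] // _;
    [right; right|left|right; left]; split; lia.
all: ring.
Qed.

Definition first_row (R : fieldType) (n : nat) : 'cV[R]_n.-1 :=
  if n == 2 %[mod 3] then xbar R n else ybar R n.

(** Adding n - 1 turns the leading entry 2 - n or -n into 1 or -1, which is what makes the word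
    3-periodic from index 0 on. *)
Lemma first_row_window (R : fieldType) (n : nat) (k : 'I_n.-1) :
    (3 < n)%N -> n <> 1 %[mod 3] ->
  let b (j : 'I_n.-1) := (n%:R - 1) * (j == 0 :> nat)%:R + first_row R n j 0 in
  b (ord_pred k) + b k + b (ordS k) = 3 * (k == 0 :> nat)%:R.
Proof.
move=> n3 n1 /=; rewrite /first_row.
case: ifP => [/eqP n2|/eqP n2]; rewrite !mxE.
- pose l : seq R := (2 - n%:R) :: flatten (nseq ((n - 2) %/ 3) [:: 1; -2; 1]).
  (* The repeated triple 1, -2, 1 starts at index 1, so the period read from index 0 is its
     rotation. *)
  apply: (@three_window _ _ (nth 0 [:: 1; 1; -2])
    (fun j => (n%:R - 1) * (j == 0)%:R + l`_j)); first by lia.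
  + case=> [_|j ltj] /=; first by ring.
    rewrite nth_flatten_nseq3 ?mulr0 ?add0r; last by lia.
    have : (j %% 3 < 3)%N by rewrite ltn_mod.
    case E: (j %% 3)%N => [|[|[|r]]] // _.
    * by have -> : (j.+1 %% 3 = 1)%N by lia.
    * by have -> : (j.+1 %% 3 = 2)%N by lia.
    * by have -> : (j.+1 %% 3 = 0)%N by lia.
  + by rewrite /=; ring.
  + have -> : (n.-1.-1 %% 3 = 0)%N by lia.
    by rewrite /=; ring.
  + have -> : (n.-1.-1 %% 3 = 0)%N by lia.
    have -> : ((n.-1 - 2) %% 3 = 2)%N by lia.
    by rewrite /=; ring.
- pose l : seq R :=
    (- n%:R) :: rcons (flatten (nseq ((n - 3) %/ 3) [:: 2; -1; -1])) 2.
  apply: (@three_window _ _ (nth 0 [:: -1; 2; -1])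
    (fun j => (n%:R - 1) * (j == 0)%:R + l`_j)); first by lia.
  + case=> [_|j ltj] /=; first by ring.
    have szl :
        size (flatten (nseq ((n - 3) %/ 3) [:: 2; -1; -1 : R])) = (n - 3)%N.
      rewrite size_flatten /shape map_nseq sumn_nseq /=; lia.
    rewrite nth_rcons szl mulr0 add0r; case: ltnP => [ltj'|gej].
      rewrite nth_flatten_nseq3; last by lia.
      have : (j %% 3 < 3)%N by rewrite ltn_mod.
      case E: (j %% 3)%N => [|[|[|r]]] // _.
      * by have -> : (j.+1 %% 3 = 1)%N by lia.
      * by have -> : (j.+1 %% 3 = 2)%N by lia.
      * by have -> : (j.+1 %% 3 = 0)%N by lia.
    (* The final 2 has index n - 2 in the whole row, which is 1 mod 3, so it continues the
       period. *)
    have -> : j = (n - 3)%N by lia.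
    by rewrite eqxx; have -> : ((n - 3).+1 %% 3 = 1)%N by lia.
  + by rewrite /=; ring.
  + have -> : (n.-1.-1 %% 3 = 1)%N by lia.
    by rewrite /=; ring.
  + have -> : (n.-1.-1 %% 3 = 1)%N by lia.
    have -> : ((n.-1 - 2) %% 3 = 0)%N by lia.
    by rewrite /=; ring.
Qed.

Definition lower_block (R : fieldType) (n : nat) : 'M[R]_n.-1 :=
  ((n%:R - 1) / 3)%:M + Mblock R n.

Lemma Ltilde_block (R : fieldType) (n : nat) :
  Ltilde R n = block_mx ((n%:R - 1) / 3)%:M (- 3^-1 *: (const_mx 1)^T)
                        (- 3^-1 *: const_mx 1) (lower_block R n).
Proof.
rewrite /Ltilde scalar_mx_block scale_block_mx opp_block_mx !add_block_mx.
by rewrite !scaler0 !scaleNr !addr0 !subr0 !add0r.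
Qed.

Lemma lower_block_window (R : realFieldType) (n : nat) :
    (3 < n)%N -> n <> 1 %[mod 3] ->
  lower_block R n *m window_mx R n.-1 = 1%:M.
Proof.
move=> n3 n1; have bP := @first_row_window R n ^~ n3 ^~ n1.
rewrite /lower_block /Mblock -(fun_if trmx) -/(first_row R n) mulrC.
case: n => [|[|m]] // in n3 n1 bP *; rewrite /= in bP *.
(* The block becomes one third of a single circulant, whose windowed first row is 3 at index 0 and
   zero elsewhere. *)
rewrite -scale_scalar_mx -scalerDr -circ_delta0 -circD -scalemxAl.
rewrite circ_mul_window.
rewrite (_ : (\row_k _) = 3 *: delta_mx 0 0).
  by rewrite circ_delta0 scale_scalar_mx mulVf ?Num.Theory.pnatr_eq0.
by apply/rowP=> k; rewrite !mxE eqxx /= -bP.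
Qed.

(** Multiplying by selector matrices on both sides extracts [D], and products do not increase
    rank. *)
Lemma mxrank_block_mx_unit (F : fieldType) (p q m : nat)
    (A : 'M[F]_(p, q)) (B : 'M_(p, m)) (C : 'M_(m, q)) (D : 'M_m) :
  D \in unitmx -> (m <= \rank (block_mx A B C D))%N.
Proof.
move=> /mxrank_unit {1}<-.
have {1}-> : D = row_mx 0 1%:M *m block_mx A B C D *m col_mx 0 1%:M.
  by rewrite mul_row_block mul_row_col !mul0mx !mul1mx mulmx0 mulmx1 !add0r.
exact: leq_trans (mxrankM_maxl _ _) (mxrankM_maxr _ _).
Qed.

Theorem theorem5p13 (R : realFieldType) (n : nat)
    (hn : (8 <= n)%N) (hmod : n <> 1 %[mod 3]) :
  \rank (Ltilde R n) = n.-1.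
Proof.
  have lt3n : (3 < n)%N by lia.
  have DQ := lower_block_window R lt3n hmod.
  have n3 : 3 != 0 :> R by rewrite Num.Theory.pnatr_eq0.
  (* Apply the inverse relation [DQ] to the all-ones vector, which the window matrix multiplies by
     3. *)
  have De : lower_block R n *m const_mx 1 = 3^-1 *: const_mx 1 :> 'cV_n.-1.
    have := mul1mx (const_mx 1 : 'cV[R]_n.-1).
    rewrite -DQ -mulmxA window_mx_ones -scalemxAr.
    by move/(congr1 ( *:%R 3^-1)); rewrite scalerA mulVf // scale1r.
  have [Dunit _] := mulmx1_unit DQ.
  rewrite Ltilde_block; apply/eqP.
  rewrite eqn_leq mxrank_block_mx_unit // andbT.
  have ker : block_mx ((n%:R - 1) / 3)%:M (- 3^-1 *: (const_mx 1)^T)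
                      (- 3^-1 *: const_mx 1) (lower_block R n)
             *m const_mx 1 = 0 :> 'cV_(1 + n.-1).
    rewrite -[X in _ *m X]vsubmxK mul_block_col.
    have -> : usubmx (const_mx 1 : 'cV[R]_(1 + n.-1)) = const_mx 1.
      by apply/matrixP=> i j; rewrite !mxE.
    have -> : dsubmx (const_mx 1 : 'cV[R]_(1 + n.-1)) = const_mx 1.
      by apply/matrixP=> i j; rewrite !mxE.
    rewrite De -scalemxAl; apply/eqP; rewrite col_mx_eq0.
    apply/andP; split; apply/eqP.
    (* Top row: (n - 1)/3 cancels against n - 1 entries equal to -1/3. *)
    - apply/matrixP=> i j; rewrite mul_scalar_mx !mxE.
      under eq_bigr => k _ do rewrite !mxE mulr1.
      have -> : n%:R = n.-1%:R + 1 :> R by rewrite natr1 prednK //; lia.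
      by rewrite sumr_const card_ord -mulr_natr; field.
    - rewrite (_ : const_mx 1 = 1%:M :> 'M_1) ?mulmx1 ?scaleNr ?addNr //.
      by apply/matrixP=> i j; rewrite !ord1 !mxE.
  have e0 : const_mx 1 != 0 :> 'cV[R]_(1 + n.-1).
    by apply/eqP=> /matrixP/(_ 0 0)/eqP; rewrite !mxE oner_eq0.
  have e_gt0 : (0 < \rank (const_mx 1%R : 'cV[R]_(1 + n.-1)))%N.
    by rewrite lt0n mxrank_eq0.
  (* A nonzero kernel vector has rank at least 1, which leaves rank at most n - 1 for the matrix. *)
  rewrite -ltnS -[X in (_ < X)%N]add1n; apply: leq_trans (mulmx0_rank_max ker).
  by rewrite -addn1 leq_add2l.
Qed.
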